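(* Let $c>0$, $\Delta x>0$, $\Delta y>0$. For $\boldsymbol{k}=(k_x,k_y)\in\mathbb{R}^2$ put $t_x=\exp(\mathrm{i}k_x\Delta x)$, $t_y=\exp(\mathrm{i}k_y\Delta y)$, and let $\mathcal{E}=\mathcal{E}(t_x,t_y)\in\mathbb{C}^{12\times 12}$ be the evolution matrix of the semi-discrete Active Flux method for two-dimensional linear acoustics with Coriolis source term, given explicitly in the context. Then $\det(\mathcal{E})=0$ for all wave numbers $\boldsymbol{k}\in\mathbb{R}^2$. The kernel of $\mathcal{E}$ is the one-dimensional space spanned by the vector $(\hat u^{A},\hat v^{A},\hat p^{A},\hat u^{E_H},\hat v^{E_H},\hat p^{E_H},\hat u^{E_V},\hat v^{E_V},\hat p^{E_V},\hat u^{N},\hat v^{N},\hat p^{N})^T$ with components $$\hat u^A=\frac{(1+4t_x+t_x^2)(1-t_y)}{3c\,\Delta y\,t_x(1+t_x)t_y},\quad \hat v^A=\frac{(t_x-1)(1+4t_y+t_y^2)}{3c\,\Delta x\,t_x t_y(1+t_y)},\quad \hat p^A=\frac{(1+4t_x+t_x^2)(1+4t_y+t_y^2)}{9t_x(1+t_x)t_y(1+t_y)},$$ $$\hat u^{E_H}=-\frac{(1+6t_x+t_x^2)(t_y-1)}{2c\,\Delta y\,t_x(1+t_x)(1+t_y)},\quad \hat v^{E_H}=\frac{t_x-1}{c\,\Delta x\,t_x},\quad \hat p^{E_H}=\frac{1+6t_x+t_x^2}{4t_x+4t_x^2},$$ $$\hat u^{E_V}=\frac{1-t_y}{c\,\Delta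 y\,t_y},\quad \hat v^{E_V}=\frac{(t_x-1)(1+6t_y+t_y^2)}{2c\,\Delta x(1+t_x)t_y(1+t_y)},\quad \hat p^{E_V}=\frac{1+6t_y+t_y^2}{4t_y+4t_y^2},$$ $$\hat u^{N}=\frac{2(1-t_y)}{c\,\Delta y+c\,\Delta y\,t_y},\quad \hat v^{N}=-\frac{2(1-t_x)}{c\,\Delta x+c\,\Delta x\,t_x},\quad \hat p^{N}=1.$$
   Context: The PDE is $\partial_t u+\partial_x p=cv$, $\partial_t v+\partial_y p=-cu$, $\partial_t p+\partial_x u+\partial_y v=0$ (linear acoustics with unit speed and Coriolis parameter $c>0$). The semi-discrete Active Flux method on a Cartesian grid with spacings $\Delta x,\Delta y$ has four types of degrees of freedom per cell: cell average ($A$), horizontal-edge midpoint ($E_H$), vertical-edge midpoint ($E_V$), node ($N$), each carrying $(u,v,p)$. Inserting a Fourier mode $q^X_{i,j}(t)=\hat q^X(t)\,t_x^i t_y^j$ gives $\frac{d}{dt}\hat{\boldsymbol q}+\mathcal{E}(t_x,t_y)\hat{\boldsymbol q}=0$ with $$\mathcal{E}=\begin{pmatrix}\mathcal{E}_{AA}&\mathcal{E}_{AE_H}&\mathcal{E}_{AE_V}&\mathcal{E}_{AN}\\ \mathcal{E}_{E_HA}&\mathcal{E}_{E_HE_H}&\mathcal{E}_{E_HE_V}&\mathcal{E}_{E_HN}\\ \mathcal{E}_{E_VA}&\mathcal{E}_{E_VE_H}&\mathcal{E}_{E_VE_V}&\mathcal{E}_{E_VN}\\ \mathcal{E}_{NA}&\mathcal{E}_{NE_H}&\mathcal{E}_{NE_V}&\mathcal{E}_{NN}\end{pmatrix},$$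 where the $3\times3$ blocks (acting on $(\hat u,\hat v,\hat p)$) are $$\mathcal{E}_{AA}=\begin{pmatrix}0&-c&0\\c&0&0\\0&0&0\end{pmatrix},\quad \mathcal{E}_{AE_H}=\frac{2}{3\Delta y}\begin{pmatrix}0&0&0\\0&0&1-t_y^{-1}\\0&1-t_y^{-1}&0\end{pmatrix},\quad \mathcal{E}_{AE_V}=\frac{2}{3\Delta x}\begin{pmatrix}0&0&1-t_x^{-1}\\0&0&0\\1-t_x^{-1}&0&0\end{pmatrix},$$ $$\mathcal{E}_{AN}=\begin{pmatrix}0&0&\alpha\\0&0&\beta\\\alpha&\beta&0\end{pmatrix},\quad \alpha=\frac{(t_x-1)(1+t_y)}{6\Delta x\,t_xt_y},\quad \beta=\frac{(1+t_x)(t_y-1)}{6\Delta y\,t_xt_y},$$ $$\mathcal{E}_{E_HA}=-\frac{9}{2\Delta y}\begin{pmatrix}0&0&0\\0&1+t_y&1-t_y\\0&1-t_y&1+t_y\end{pmatrix},\quad \mathcal{E}_{E_HE_H}=\begin{pmatrix}0&-c&0\\c&\frac{t_y^{-1}+4+t_y}{\Delta y}&\frac{t_y^{-1}-t_y}{\Delta y}\\0&\frac{t_y^{-1}-t_y}{\Delta y}&\frac{t_y^{-1}+4+t_y}{\Delta y}\end{pmatrix},$$ $$\mathcal{E}_{E_HE_V}=\frac{1+t_x}{2\Delta y\,t_x}\begin{pmatrix}0&0&0\\0&1+t_y&1-t_y\\0&1-t_y&1+t_y\end{pmatrix},\quad \mathcal{E}_{E_HN}=\begin{pmatrix}0&0&\frac{1-t_x^{-1}}{\Delta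 x}\\0&\frac{(1+t_x)(1+t_y)^2}{8\Delta y\,t_xt_y}&-\frac{(1+t_x)(t_y^2-1)}{8\Delta y\,t_xt_y}\\\frac{1-t_x^{-1}}{\Delta x}&-\frac{(1+t_x)(t_y^2-1)}{8\Delta y\,t_xt_y}&\frac{(1+t_x)(1+t_y)^2}{8\Delta y\,t_xt_y}\end{pmatrix},$$ $$\mathcal{E}_{E_VA}=-\frac{9}{2\Delta x}\begin{pmatrix}1+t_x&0&1-t_x\\0&0&0\\1-t_x&0&1+t_x\end{pmatrix},\quad \mathcal{E}_{E_VE_H}=\frac{1+t_y}{2\Delta x\,t_y}\begin{pmatrix}1+t_x&0&1-t_x\\0&0&0\\1-t_x&0&1+t_x\end{pmatrix},$$ $$\mathcal{E}_{E_VE_V}=\begin{pmatrix}\frac{t_x^{-1}+4+t_x}{\Delta x}&-c&\frac{t_x^{-1}-t_x}{\Delta x}\\c&0&0\\\frac{t_x^{-1}-t_x}{\Delta x}&0&\frac{t_x^{-1}+4+t_x}{\Delta x}\end{pmatrix},\quad \mathcal{E}_{E_VN}=\begin{pmatrix}\frac{(1+t_x)^2(1+t_y)}{8\Delta x\,t_xt_y}&0&-\frac{(t_x^2-1)(1+t_y)}{8\Delta x\,t_xt_y}\\0&0&\frac{1-t_y^{-1}}{\Delta y}\\-\frac{(t_x^2-1)(1+t_y)}{8\Delta x\,t_xt_y}&\frac{1-t_y^{-1}}{\Delta y}&\frac{(1+t_x)^2(1+t_y)}{8\Delta x\,t_xt_y}\end{pmatrix},$$ $$\mathcal{E}_{NA}=0,\quad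 \mathcal{E}_{NE_H}=-\frac{2}{\Delta x}\begin{pmatrix}1+t_x&0&1-t_x\\0&0&0\\1-t_x&0&1+t_x\end{pmatrix},\quad \mathcal{E}_{NE_V}=-\frac{2}{\Delta y}\begin{pmatrix}0&0&0\\0&1+t_y&1-t_y\\0&1-t_y&1+t_y\end{pmatrix},$$ $$\mathcal{E}_{NN}=\begin{pmatrix}\frac{t_x^{-1}+6+t_x}{2\Delta x}&-c&\frac{t_x^{-1}-t_x}{2\Delta x}\\c&\frac{t_y^{-1}+6+t_y}{2\Delta y}&\frac{t_y^{-1}-t_y}{2\Delta y}\\\frac{t_x^{-1}-t_x}{2\Delta x}&\frac{t_y^{-1}-t_y}{2\Delta y}&\frac{t_x^{-1}+6+t_x}{2\Delta x}+\frac{t_y^{-1}+6+t_y}{2\Delta y}\end{pmatrix}.$$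
   Formalization: The displayed spanning vector is undefined when t_x = -1 or t_y = -1, so the claim that it spans the kernel is stated only for t_x ≠ -1 and t_y ≠ -1; det(E) = 0 and one-dimensionality of the kernel are stated for all k. *)

(* Defs.v *)
From mathcomp Require Import all_boot all_order all_algebra.
From mathcomp Require Import complex reals trigo.

Set Implicit Arguments.
Unset Strict Implicit.
Unset Printing Implicit Defensive.

Import Order.TTheory GRing.Theory Num.Theory.
Local Open Scope ring_scope.

(* exp (i x) for real x, by Euler's formula: no exponential is available on
   the type R[i]. *)
Definition expi (R : realType) (x : R) : R[i] := Complex (cos x) (sin x).

Definition mx3 (F : fieldType) (rows : seq (seq F)) : 'M[F]_3 :=
  \matrix_(i < 3, j < 3) nth 0 (nth [::] rows i) j.

Definition cv3 (F : fieldType) (u v p : F) : 'cV[F]_3 :=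
  \col_(i < 3) nth 0 [:: u; v; p] i.

Section ActiveFlux.

Variables (F : fieldType) (c dx dy tx ty : F).

Definition upwx : 'M[F]_3 :=
  mx3 [:: [:: 1 + tx; 0; 1 - tx];
          [:: 0;      0; 0     ];
          [:: 1 - tx; 0; 1 + tx]].

Definition upwy : 'M[F]_3 :=
  mx3 [:: [:: 0; 0;      0     ];
          [:: 0; 1 + ty; 1 - ty];
          [:: 0; 1 - ty; 1 + ty]].

(* Subscripts A, H, V, N stand for the cell averages, the horizontal and the
   vertical edge midpoints, and the nodes. *)

Definition E_AA : 'M[F]_3 :=
  mx3 [:: [:: 0; - c; 0];
          [:: c; 0;   0];
          [:: 0; 0;   0]].

Definition E_AH : 'M[F]_3 :=
  (2 / (3 * dy)) *: mx3 [:: [:: 0; 0;         0        ];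
                            [:: 0; 0;         1 - ty^-1];
                            [:: 0; 1 - ty^-1; 0        ]].

Definition E_AV : 'M[F]_3 :=
  (2 / (3 * dx)) *: mx3 [:: [:: 0;         0; 1 - tx^-1];
                            [:: 0;         0; 0        ];
                            [:: 1 - tx^-1; 0; 0        ]].

Definition E_AN : 'M[F]_3 :=
  let alpha := ((tx - 1) * (1 + ty)) / (6 * dx * tx * ty) in
  let beta := ((1 + tx) * (ty - 1)) / (6 * dy * tx * ty) in
  mx3 [:: [:: 0;     0;    alpha];
          [:: 0;     0;    beta ];
          [:: alpha; beta; 0    ]].

Definition E_HA : 'M[F]_3 := (- (9 / (2 * dy))) *: upwy.

Definition E_HH : 'M[F]_3 :=
  let d := (ty^-1 + 4 + ty) / dy in
  let e := (ty^-1 - ty) / dy in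
  mx3 [:: [:: 0; - c; 0];
          [:: c; d;   e];
          [:: 0; e;   d]].

Definition E_HV : 'M[F]_3 := ((1 + tx) / (2 * dy * tx)) *: upwy.

Definition E_HN : 'M[F]_3 :=
  let g := (1 - tx^-1) / dx in
  let d := ((1 + tx) * (1 + ty) ^+ 2) / (8 * dy * tx * ty) in
  let e := - (((1 + tx) * (ty ^+ 2 - 1)) / (8 * dy * tx * ty)) in
  mx3 [:: [:: 0; 0; g];
          [:: 0; d; e];
          [:: g; e; d]].

Definition E_VA : 'M[F]_3 := (- (9 / (2 * dx))) *: upwx.

Definition E_VH : 'M[F]_3 := ((1 + ty) / (2 * dx * ty)) *: upwx.

Definition E_VV : 'M[F]_3 :=
  let d := (tx^-1 + 4 + tx) / dx in
  let e := (tx^-1 - tx) / dx in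
  mx3 [:: [:: d; - c; e];
          [:: c; 0;   0];
          [:: e; 0;   d]].

Definition E_VN : 'M[F]_3 :=
  let g := (1 - ty^-1) / dy in
  let d := ((1 + tx) ^+ 2 * (1 + ty)) / (8 * dx * tx * ty) in
  let e := - (((tx ^+ 2 - 1) * (1 + ty)) / (8 * dx * tx * ty)) in
  mx3 [:: [:: d; 0; e];
          [:: 0; 0; g];
          [:: e; g; d]].

Definition E_NA : 'M[F]_3 := 0.

Definition E_NH : 'M[F]_3 := (- (2 / dx)) *: upwx.

Definition E_NV : 'M[F]_3 := (- (2 / dy)) *: upwy.

Definition E_NN : 'M[F]_3 :=
  let dX := (tx^-1 + 6 + tx) / (2 * dx) in
  let dY := (ty^-1 + 6 + ty) / (2 * dy) in
  let eX := (tx^-1 - tx) / (2 * dx) in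
  let eY := (ty^-1 - ty) / (2 * dy) in
  mx3 [:: [:: dX; - c; eX     ];
          [:: c;  dY;  eY     ];
          [:: eX; eY;  dX + dY]].

Definition evolution_mx : 'M[F]_(3 + 3 + (3 + 3)) :=
  block_mx (block_mx E_AA E_AH
                     E_HA E_HH)   (block_mx E_AV E_AN
                                            E_HV E_HN)
           (block_mx E_VA E_VH
                     E_NA E_NH)   (block_mx E_VV E_VN
                                            E_NV E_NN).

Definition ker_A : 'cV[F]_3 :=
  cv3 (((1 + 4 * tx + tx ^+ 2) * (1 - ty))
         / (3 * c * dy * tx * (1 + tx) * ty))
      (((tx - 1) * (1 + 4 * ty + ty ^+ 2))
         / (3 * c * dx * tx * ty * (1 + ty)))
      (((1 + 4 * tx + tx ^+ 2) * (1 + 4 * ty + ty ^+ 2))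
         / (9 * tx * (1 + tx) * ty * (1 + ty))).

Definition ker_H : 'cV[F]_3 :=
  cv3 (- (((1 + 6 * tx + tx ^+ 2) * (ty - 1))
            / (2 * c * dy * tx * (1 + tx) * (1 + ty))))
      ((tx - 1) / (c * dx * tx))
      ((1 + 6 * tx + tx ^+ 2) / (4 * tx + 4 * tx ^+ 2)).

Definition ker_V : 'cV[F]_3 :=
  cv3 ((1 - ty) / (c * dy * ty))
      (((tx - 1) * (1 + 6 * ty + ty ^+ 2))
         / (2 * c * dx * (1 + tx) * ty * (1 + ty)))
      ((1 + 6 * ty + ty ^+ 2) / (4 * ty + 4 * ty ^+ 2)).

Definition ker_N : 'cV[F]_3 :=
  cv3 ((2 * (1 - ty)) / (c * dy + c * dy * ty))
      (- ((2 * (1 - tx)) / (c * dx + c * dx * tx)))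
      1.

(* Since x / 0 = 0 in F, this is the intended vector only when 1 + tx and
   1 + ty are nonzero. *)
Definition ker_vec : 'cV[F]_(3 + 3 + (3 + 3)) :=
  col_mx (col_mx ker_A ker_H) (col_mx ker_V ker_N).

End ActiveFlux.

(* Main.v *)
Require Import Defs.
From mathcomp Require Import all_boot all_order all_algebra.
From mathcomp Require Import complex reals trigo.
From mathcomp Require Import ring lra.

(* With [s = exp (i kx dx / 2)] and [r = exp (i ky dy / 2)], conjugating [E] by
   the diagonal matrix that multiplies u and v by [i] and the degrees of freedom
   H, V, N by [r], [s], [r * s] gives [c] times a real matrix whose entries are
   polynomials in the cosines [X], [Y] and sines [Sx], [Sy] of the half angles,
   with [a = 1 / (c dx)] and [b = 1 / (c dy)].  The kernel vector, multiplied
   by [s r X Y], becomes polynomial in these quantities and its pressure average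
   (1 + 2 X^2) (1 + 2 Y^2) / 9 never vanishes, so it remains to show that the
   real kernel is at most one-dimensional.  If [Sx Y] and [Sy X] are not both
   zero, the divergence equation determines the nodal velocity up to a scalar,
   and a kernel element without nodal velocity is described by two amplitudes
   that vanish by a sign argument.  Otherwise [Sx = Sy = 0] or [X = Y = 0], and
   a kernel element with zero pressure average is found to vanish directly. *)

Set Implicit Arguments.
Unset Strict Implicit.
Unset Printing Implicit Defensive.

Import Order.TTheory GRing.Theory Num.Theory.
Local Open Scope ring_scope.
Local Open Scope complex_scope.

(** * Entrywise arithmetic of blocks of size three *)

Lemma mul_mx3_cv3 (F : fieldType)
    (a11 a12 a13 a21 a22 a23 a31 a32 a33 u v p : F) :
  mx3 [:: [:: a11; a12; a13]; [:: a21; a22; a23]; [:: a31; a32; a33]]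
    *m cv3 u v p
  = cv3 (a11 * u + a12 * v + a13 * p) (a21 * u + a22 * v + a23 * p)
        (a31 * u + a32 * v + a33 * p).
Proof.
apply/matrixP => i j; rewrite !mxE 3!big_ord_recr big_ord0 /= !mxE /= add0r.
by case: i => [[|[|[|]]]].
Qed.

Lemma addcv3 (F : fieldType) (u v p u' v' p' : F) :
  cv3 u v p + cv3 u' v' p' = cv3 (u + u') (v + v') (p + p').
Proof. by apply/matrixP => i j; rewrite !mxE; case: i => [[|[|[|]]]]. Qed.

Lemma scalecv3 (F : fieldType) (k u v p : F) :
  k *: cv3 u v p = cv3 (k * u) (k * v) (k * p).
Proof. by apply/matrixP => i j; rewrite !mxE; case: i => [[|[|[|]]]]. Qed.

Lemma cv3_0 (F : fieldType) : cv3 0 0 0 = 0 :> 'cV[F]_3.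
Proof. by apply/matrixP => i j; rewrite !mxE; case: i => [[|[|[|]]]]. Qed.

Lemma cv3E (F : fieldType) (x : 'cV[F]_3) :
  x = cv3 (x 0 0) (x 1 0) (x (inord 2) 0).
Proof.
apply/matrixP => i j; rewrite !mxE (ord1 j).
case: i => [[|[|[|]]]] //= h; congr (x _ _); apply: val_inj => //=.
by rewrite inordK.
Qed.

Lemma cv3_inj (F : fieldType) (u v p u' v' p' : F) :
  cv3 u v p = cv3 u' v' p' -> [/\ u = u', v = v' & p = p'].
Proof.
move=> /matrixP h; split.
- by have := h 0 0; rewrite !mxE.
- by have := h 1 0; rewrite !mxE.
- by have := h (inord 2) 0; rewrite !mxE inordK.
Qed.

(** * The real half-angle matrix and its kernel vector *)

Section HalfAngle.

Variables (F : fieldType) (a b X Sx Y Sy : F).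

Definition upx : 'M[F]_3 :=
  mx3 [:: [:: X; 0; - Sx]; [:: 0; 0; 0]; [:: Sx; 0; X]].
Definition upy : 'M[F]_3 :=
  mx3 [:: [:: 0; 0; 0]; [:: 0; Y; - Sy]; [:: 0; Sy; Y]].

Definition K_AA : 'M[F]_3 :=
  mx3 [:: [:: 0; - 1; 0]; [:: 1; 0; 0]; [:: 0; 0; 0]].
Definition K_AH : 'M[F]_3 :=
  (4 * b * Sy / 3) *: mx3 [:: [:: 0; 0; 0]; [:: 0; 0; 1]; [:: 0; - 1; 0]].
Definition K_AV : 'M[F]_3 :=
  (4 * a * Sx / 3) *: mx3 [:: [:: 0; 0; 1]; [:: 0; 0; 0]; [:: - 1; 0; 0]].
Definition K_AN : 'M[F]_3 :=
  let al := 2 * a * Sx * Y / 3 in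
  let be := 2 * b * Sy * X / 3 in
  mx3 [:: [:: 0; 0; al]; [:: 0; 0; be]; [:: - al; - be; 0]].

Definition K_HA : 'M[F]_3 := (- (9 * b)) *: upy.
Definition K_HH : 'M[F]_3 :=
  let d := b * (2 + 4 * Y ^+ 2) in
  let e := 4 * b * Sy * Y in
  mx3 [:: [:: 0; - 1; 0]; [:: 1; d; - e]; [:: 0; e; d]].
Definition K_HV : 'M[F]_3 := (2 * b * X) *: upy.
Definition K_HN : 'M[F]_3 :=
  let g := 2 * a * Sx in
  let d := b * X * Y ^+ 2 in
  let e := b * X * Y * Sy in
  mx3 [:: [:: 0; 0; g]; [:: 0; d; - e]; [:: - g; e; d]].

Definition K_VA : 'M[F]_3 := (- (9 * a)) *: upx.
Definition K_VH : 'M[F]_3 := (2 * a * Y) *: upx.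
Definition K_VV : 'M[F]_3 :=
  let d := a * (2 + 4 * X ^+ 2) in
  let e := 4 * a * Sx * X in
  mx3 [:: [:: d; - 1; - e]; [:: 1; 0; 0]; [:: e; 0; d]].
Definition K_VN : 'M[F]_3 :=
  let g := 2 * b * Sy in
  let d := a * X ^+ 2 * Y in
  let e := a * X * Y * Sx in
  mx3 [:: [:: d; 0; - e]; [:: 0; 0; g]; [:: e; - g; d]].

Definition K_NH : 'M[F]_3 := (- (4 * a)) *: upx.
Definition K_NV : 'M[F]_3 := (- (4 * b)) *: upy.
Definition K_NN : 'M[F]_3 :=
  let dX := a * (2 + 2 * X ^+ 2) in
  let dY := b * (2 + 2 * Y ^+ 2) in
  let eX := 2 * a * Sx * X in
  let eY := 2 * b * Sy * Y in
  mx3 [:: [:: dX; - 1; - eX]; [:: 1; dY; - eY]; [:: eX; eY; dX + dY]].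

(** The field is arbitrary because the matrix is used twice: over an ordered field for the sign
    arguments and over [R[i]] for the similarity with [evolution_mx]. *)
Definition half_mx : 'M[F]_(3 + 3 + (3 + 3)) :=
  block_mx (block_mx K_AA K_AH K_HA K_HH) (block_mx K_AV K_AN K_HV K_HN)
           (block_mx K_VA K_VH 0    K_NH) (block_mx K_VV K_VN K_NV K_NN).

Definition half_ker : 'cV[F]_(3 + 3 + (3 + 3)) :=
  col_mx
    (col_mx (cv3 (- (2 * b * Sy * Y * (1 + 2 * X ^+ 2) / 3))
                 (2 * a * Sx * X * (1 + 2 * Y ^+ 2) / 3)
                 ((1 + 2 * X ^+ 2) * (1 + 2 * Y ^+ 2) / 9))
            (cv3 (- (b * Sy * (1 + X ^+ 2))) (2 * a * Sx * X * Y)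
                 (Y * (1 + X ^+ 2) / 2)))
    (col_mx (cv3 (- (2 * b * Sy * X * Y)) (a * Sx * (1 + Y ^+ 2))
                 (X * (1 + Y ^+ 2) / 2))
            (cv3 (- (2 * b * Sy * X)) (2 * a * Sx * Y) (X * Y))).

End HalfAngle.

(** Kernel elements are studied through these twelve scalar equations. Below they are called [A1],
    ..., [N3]: the letter is the type of degree of freedom, and 1, 2, 3 stand for the u, v, p
    rows. *)
Lemma half_mxE (F : fieldType) (a b X Sx Y Sy : F)
    (uA vA pA uH vH pH uV vV pV uN vN pN : F) :
  half_mx a b X Sx Y Sy *m
    col_mx (col_mx (cv3 uA vA pA) (cv3 uH vH pH))
           (col_mx (cv3 uV vV pV) (cv3 uN vN pN)) =
  col_mx
    (col_mx
      (cv3 (- vA + 2 * a * Sx / 3 * (2 * pV + Y * pN))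
           (uA + 2 * b * Sy / 3 * (2 * pH + X * pN))
           (- (2 * b * Sy / 3 * (2 * vH + X * vN)
               + 2 * a * Sx / 3 * (2 * uV + Y * uN))))
      (cv3 (- vH + 2 * a * Sx * pN)
           (uH + b * (- 9 * Y * vA + 9 * Sy * pA + (2 + 4 * Y ^+ 2) * vH
              - 4 * Sy * Y * pH + 2 * X * Y * vV - 2 * X * Sy * pV
              + X * Y ^+ 2 * vN - X * Y * Sy * pN))
           (- 2 * a * Sx * uN + b * (- 9 * Sy * vA - 9 * Y * pA
              + 4 * Sy * Y * vH + (2 + 4 * Y ^+ 2) * pH + 2 * X * Sy * vV
              + 2 * X * Y * pV + X * Y * Sy * vN + X * Y ^+ 2 * pN))))
    (col_mx
      (cv3 (- vV + a * (- 9 * X * uA + 9 * Sx * pA + (2 + 4 * X ^+ 2) * uV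
              - 4 * Sx * X * pV + 2 * X * Y * uH - 2 * Y * Sx * pH
              + X ^+ 2 * Y * uN - X * Y * Sx * pN))
           (uV + 2 * b * Sy * pN)
           (- 2 * b * Sy * vN + a * (- 9 * Sx * uA - 9 * X * pA
              + 4 * Sx * X * uV + (2 + 4 * X ^+ 2) * pV + 2 * Y * Sx * uH
              + 2 * X * Y * pH + X * Y * Sx * uN + X ^+ 2 * Y * pN)))
      (cv3 (- vN + a * (- 4 * X * uH + 4 * Sx * pH + (2 + 2 * X ^+ 2) * uN
              - 2 * Sx * X * pN))
           (uN + b * (- 4 * Y * vV + 4 * Sy * pV + (2 + 2 * Y ^+ 2) * vN
              - 2 * Sy * Y * pN))
           (a * (- 4 * Sx * uH - 4 * X * pH + (2 + 2 * X ^+ 2) * pN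
              + 2 * Sx * X * uN)
            + b * (- 4 * Sy * vV - 4 * Y * pV + (2 + 2 * Y ^+ 2) * pN
              + 2 * Sy * Y * vN)))).
Proof.
rewrite /half_mx !(mul_block_col, add_col_mx).
rewrite !(mul0mx, =^~ scalemxAl, mul_mx3_cv3, scalecv3, addcv3, add0r, addcv3).
congr (col_mx (col_mx _ _) (col_mx _ _)); congr cv3; ring.
Qed.

Lemma half_mx_ker (R : realFieldType) (a b X Sx Y Sy : R) :
  X ^+ 2 + Sx ^+ 2 = 1 -> Y ^+ 2 + Sy ^+ 2 = 1 ->
  half_mx a b X Sx Y Sy *m half_ker a b X Sx Y Sy = 0.
Proof.
move=> hX hY; have eX : Sx ^+ 2 = 1 - X ^+ 2 by rewrite -hX; ring.
have eY : Sy ^+ 2 = 1 - Y ^+ 2 by rewrite -hY; ring.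
rewrite half_mxE -(col_mx0 _ (3 + 3) (3 + 3)) -(col_mx0 _ 3 3) -cv3_0.
by congr (col_mx (col_mx _ _) (col_mx _ _)); congr cv3; field: eX eY.
Qed.

(** * Base change along a morphism of fields *)

Lemma map_mx3 (F G : fieldType) (h : {rmorphism F -> G})
    (a11 a12 a13 a21 a22 a23 a31 a32 a33 : F) :
  map_mx h (mx3 [:: [:: a11; a12; a13]; [:: a21; a22; a23]; [:: a31; a32; a33]])
  = mx3 [:: [:: h a11; h a12; h a13]; [:: h a21; h a22; h a23];
            [:: h a31; h a32; h a33]].
Proof.
apply/matrixP => i j; rewrite !mxE.
by case: i => [[|[|[|]]]] //= ?; case: j => [[|[|[|]]]].
Qed.

Lemma map_cv3 (F G : fieldType) (h : {rmorphism F -> G}) (u v p : F) :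
  map_mx h (cv3 u v p) = cv3 (h u) (h v) (h p).
Proof. by apply/matrixP => i j; rewrite !mxE; case: i => [[|[|[|]]]]. Qed.

Section Map.
Variables (F G : fieldType) (h : {rmorphism F -> G}) (a b X Sx Y Sy : F).

Let hE := (rmorph0, rmorph1, rmorphN, rmorphM, rmorphD, rmorphXn, fmorphV,
  rmorph_nat).

Lemma map_half_mx : map_mx h (half_mx a b X Sx Y Sy)
  = half_mx (h a) (h b) (h X) (h Sx) (h Y) (h Sy).
Proof.
rewrite /half_mx !map_block_mx map_mx0.
by congr (block_mx (block_mx _ _ _ _) (block_mx _ _ _ _)
                   (block_mx _ _ _ _) (block_mx _ _ _ _));
  rewrite ?map_mxZ map_mx3 ?hE.
Qed.

Lemma map_half_ker : map_mx h (half_ker a b X Sx Y Sy)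
  = half_ker (h a) (h b) (h X) (h Sx) (h Y) (h Sy).
Proof. by rewrite /half_ker !map_col_mx !map_cv3 !hE. Qed.
End Map.

(** * Similarity between the evolution matrix and the half-angle matrix *)

Definition diag3 (F : fieldType) (i : F) : 'M[F]_3 :=
  mx3 [:: [:: i; 0; 0]; [:: 0; i; 0]; [:: 0; 0; 1]].

(* The parameters [s] and [r] are the square roots of [tx] and [ty]. *)
Definition phase_mx (F : fieldType) (i s r : F) : 'M[F]_(3 + 3 + (3 + 3)) :=
  block_mx (block_mx (diag3 i) 0 0 (r *: diag3 i)) 0
           0 (block_mx (s *: diag3 i) 0 0 ((r * s) *: diag3 i)).

Lemma mul_mx3 (F : fieldType) (a11 a12 a13 a21 a22 a23 a31 a32 a33
   b11 b12 b13 b21 b22 b23 b31 b32 b33 : F) :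
  mx3 [:: [:: a11; a12; a13]; [:: a21; a22; a23]; [:: a31; a32; a33]] *m
  mx3 [:: [:: b11; b12; b13]; [:: b21; b22; b23]; [:: b31; b32; b33]] =
  mx3 [:: [:: a11 * b11 + a12 * b21 + a13 * b31;
              a11 * b12 + a12 * b22 + a13 * b32;
              a11 * b13 + a12 * b23 + a13 * b33];
          [:: a21 * b11 + a22 * b21 + a23 * b31;
              a21 * b12 + a22 * b22 + a23 * b32;
              a21 * b13 + a22 * b23 + a23 * b33];
          [:: a31 * b11 + a32 * b21 + a33 * b31;
              a31 * b12 + a32 * b22 + a33 * b32;
              a31 * b13 + a32 * b23 + a33 * b33]].
Proof.
apply/matrixP => i j; rewrite !mxE 3!big_ord_recr big_ord0 /= !mxE /= add0r.
by case: i => [[|[|[|]]]] //= ?; case: j => [[|[|[|]]]].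
Qed.

Lemma scale_mx3 (F : fieldType) (k a11 a12 a13 a21 a22 a23 a31 a32 a33 : F) :
  k *: mx3 [:: [:: a11; a12; a13]; [:: a21; a22; a23]; [:: a31; a32; a33]]
  = mx3 [:: [:: k * a11; k * a12; k * a13]; [:: k * a21; k * a22; k * a23];
            [:: k * a31; k * a32; k * a33]].
Proof.
apply/matrixP => i j; rewrite !mxE.
by case: i => [[|[|[|]]]] //= ?; case: j => [[|[|[|]]]].
Qed.

Section Similarity.
Variables (F : numFieldType) (i c dx dy s r : F).
Hypotheses (ii : i ^+ 2 = - 1) (c0 : c != 0) (dx0 : dx != 0) (dy0 : dy != 0)
  (s0 : s != 0) (r0 : r != 0).

Let X := (s + s^-1) / 2.
Let Sx := - (i * (s - s^-1) / 2).
Let Y := (r + r^-1) / 2.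
Let Sy := - (i * (r - r^-1) / 2).

(** With [tx = s ^+ 2] one has [1 + tx = 2 s X] and [1 - tx = - 2 i s Sx], and likewise for [ty].
    The leftover powers of [s] and [r] are the phase offsets between the four types of degrees of
    freedom, and the factor [i] on the velocities absorbs the one in front of the sines. *)
Lemma evolution_half :
  evolution_mx c dx dy (s ^+ 2) (r ^+ 2) *m phase_mx i s r
  = c *: (phase_mx i s r *m half_mx (c * dx)^-1 (c * dy)^-1 X Sx Y Sy).
Proof.
rewrite /phase_mx /evolution_mx /half_mx !mulmx_block.
rewrite !(mul0mx, mulmx0, add0r, addr0) !scale_block_mx.
congr (block_mx (block_mx _ _ _ _) (block_mx _ _ _ _)
                   (block_mx _ _ _ _) (block_mx _ _ _ _));
rewrite /E_NA ?mul0mx ?mulmx0 ?scaler0 //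
 /E_AA /E_AH /E_AV /E_AN /E_HA /E_HH /E_HV /E_HN /E_VA /E_VH /E_VV /E_VN
 /E_NH /E_NV /E_NN /upwx /upwy
 /K_AA /K_AH /K_AV /K_AN /K_HA /K_HH /K_HV /K_HN /K_VA /K_VH /K_VV /K_VN
 /K_NH /K_NV /K_NN /upx /upy /diag3 /X /Sx /Y /Sy
 ?(scale_mx3, mul_mx3).
all: congr mx3; repeat (congr cons); field: ii.
all: by rewrite ?c0 ?dx0 ?dy0 ?s0 ?r0.
Qed.

(** The denominators [1 + tx = 2 s X] and [1 + ty = 2 r Y] of [ker_vec] are cleared by the factor
    [s r X Y]; the hypotheses keep these divisions genuine. *)
Lemma ker_vec_half : 1 + s ^+ 2 != 0 -> 1 + r ^+ 2 != 0 ->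
  phase_mx i s r *m half_ker (c * dx)^-1 (c * dy)^-1 X Sx Y Sy
  = (s * r * X * Y) *: ker_vec c dx dy (s ^+ 2) (r ^+ 2).
Proof.
move=> s1 r1.
have h (z : F) : z != 0 -> 1 + z ^+ 2 != 0 -> 4 * z ^+ 2 + 4 * z ^+ 4 != 0.
  move=> z0 z1.
  have -> : 4 * z ^+ 2 + 4 * z ^+ 4 = 4 * z ^+ 2 * (1 + z ^+ 2) by ring.
  by rewrite !mulf_neq0 ?sqrf_eq0 ?pnatr_eq0.
have h' (d z : F) : d != 0 -> 1 + z ^+ 2 != 0 -> c * d + c * d * z ^+ 2 != 0.
  move=> d0 z1; have -> : c * d + c * d * z ^+ 2 = c * d * (1 + z ^+ 2) by ring.
  by rewrite !mulf_neq0.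
rewrite /phase_mx /half_ker /ker_vec !mul_block_col.
rewrite !(mul0mx, add0r, addr0) !scale_col_mx.
congr (col_mx (col_mx _ _) (col_mx _ _));
rewrite /diag3 /ker_A /ker_H /ker_V /ker_N /X /Y /Sx /Sy
  ?scale_mx3 mul_mx3_cv3 ?scalecv3.
all: congr cv3; field: ii.
all: by rewrite ?h ?h' ?c0 ?dx0 ?dy0 ?s0 ?r0 ?s1 ?r1.
Qed.

End Similarity.

(** * Sign argument for the edge amplitudes *)

(* [2 X u = S (2 p - X P)] is the upwind nodal equation for an edge pressure [p],
   edge velocity [u] and nodal pressure [P] in the absence of nodal velocity. *)
Lemma edge_amplitude (R : realFieldType) (X S u p P : R) :
  X ^+ 2 + S ^+ 2 = 1 ->
  2 * X * u = S * (2 * p - X * P) ->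
  exists2 mu, u = S * mu / 2 & p = X * (mu + P) / 2.
Proof.
(* The equation makes [(2 u, 2 p - X P)] parallel to the unit vector [(S, X)]; the witness is their
   scalar product. *)
move=> hX h; exists (2 * S * u + X * (2 * p - X * P)).
- have : (X ^+ 2 + S ^+ 2) * u = u by rewrite hX mul1r.
  have : X * (2 * X * u) = X * (S * (2 * p - X * P)) by rewrite h.
  lra.
- have : S * (2 * X * u) = S * (S * (2 * p - X * P)) by rewrite h.
  have : (X ^+ 2 + S ^+ 2) * (2 * p - X * P) = 2 * p - X * P.
    by rewrite hX mul1r.
  lra.
Qed.

(* [P] is the nodal pressure and [P - b t], [P + a t] are the amplitudes [mu] that
   edge_amplitude gives for the horizontal and the vertical edges. *)
Lemma amplitudes_eq0 (R : realFieldType) (a b X Sx Y Sy P t : R) :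
  0 < a -> 0 < b ->
  let n := 12 * a * b - 1 in
  let Q := 3 * P + (a - b) * t in
  (Sx * Y != 0) || (Sy * X != 0) ->
  Sx * Y * (n * P + (12 * a ^+ 2 * b + b) * t) = 2 * b * (Sy * X) * Q ->
  Sy * X * (- n * P + (12 * a * b ^+ 2 + a) * t) = 2 * a * (Sx * Y) * Q ->
  Sx * Sy * P * (1 + 8 * a * b) = - (4 * a * b * X * Y * t) ->
  P = 0 /\ t = 0.
Proof.
move=> a0 b0 n Q fg0 e1 e2 e3.
set f := Sx * Y in fg0 e1 e2; set g := Sy * X in fg0 e1 e2.
set A1 := n * P + _ in e1; set A2 := - n * P + _ in e2.
have ab0 : 0 < a * b by apply: mulr_gt0.
(* In [b g e1 + b f e2] the terms in [n P] cancel, so [Q] is a positive multiple of [f g t]; [e3]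
   times [X Y t] gives [f g t P <= 0]. *)
have PQ : P * Q <= 0.
  have L0 : 0 < 2 * (b * g) ^+ 2 + 2 * a * b * f ^+ 2.
    have f2 : 0 <= a * b * f ^+ 2 by apply: mulr_ge0; rewrite ?sqr_ge0 // ltW.
    have g2 : 0 <= (b * g) ^+ 2 by rewrite sqr_ge0.
    case/orP: fg0 => h.
      have f3 : 0 < a * b * f ^+ 2 by rewrite mulr_gt0 ?exprn_even_gt0.
      lra.
    have : 0 < (b * g) ^+ 2 by rewrite exprn_even_gt0 //= mulf_neq0 // gt_eqF.
    lra.
  have h1 : f * g * t * (b * (a + b) * (12 * a * b + 1)) =
            Q * (2 * (b * g) ^+ 2 + 2 * a * b * f ^+ 2).
    have := congr1 (fun z => b * g * z) e1.
    have := congr1 (fun z => b * f * z) e2.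
    rewrite /A1 /A2 /n; lra.
  have h2 : f * g * t * P * (1 + 8 * a * b) = - (4 * a * b * (X * Y * t) ^+ 2).
    have := congr1 (fun z => X * Y * t * z) e3; rewrite /f /g; lra.
  have h3 : f * g * t * P <= 0.
    have : f * g * t * P * (1 + 8 * a * b) <= 0.
      by rewrite h2 oppr_le0 mulr_ge0 ?sqr_ge0 // -mulrA mulr_ge0 // ltW.
    by rewrite pmulr_lle0 //; lra.
  have : P * Q * (2 * (b * g) ^+ 2 + 2 * a * b * f ^+ 2) <= 0.
    rewrite -mulrA -h1 mulrA (mulrC P) mulr_le0_ge0 //.
    by rewrite mulr_ge0 // ?mulr_ge0 ?addr_ge0 //; lra.
  by rewrite pmulr_lle0.
have quad : A1 * A2 = 4 * a * b * Q ^+ 2 -> P = 0 /\ t = 0.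
  move=> h.
  (* This is [a b ((12 a^2 + 1) (12 b^2 + 1) - 4 (a - b)^2)], expanded into positive terms. *)
  pose q := 144 * (a * b) ^+ 3 + a * b + 8 * (a * b) * (a ^+ 2 + b ^+ 2)
            + 8 * (a * b) ^+ 2.
  have PQ' : (a - b) * t * P <= - (3 * P ^+ 2) by move: PQ; rewrite /Q; lra.
  (* [P Q <= 0] turns [A1 A2 = 4 a b Q^2] into a vanishing sum of
     nonnegative terms. *)
  have h4 : 2 * n ^+ 2 * P ^+ 2 + 36 * (a * b) * P ^+ 2
    + t ^+ 2 * q <= 0.
    have k1 : n ^+ 2 * ((a - b) * t * P) <= n ^+ 2 * (- (3 * P ^+ 2)).
      by rewrite ler_wpM2l ?sqr_ge0.
    have k2 : (a * b) * ((a - b) * t * P) <= (a * b) * (- (3 * P ^+ 2)).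
      by rewrite ler_wpM2l // ltW.
    move: h k1 k2; rewrite /q /A1 /A2 /Q /n; lra.
  have P2 := sqr_ge0 P; have t2 := sqr_ge0 t.
  have n2 : 0 <= 2 * n ^+ 2 * P ^+ 2.
    by apply: mulr_ge0; rewrite // mulr_ge0 ?sqr_ge0 ?ler0n.
  have c0 : 0 < q.
    by rewrite /q !addr_gt0 // ?mulr_gt0 ?addr_gt0 ?exprn_gt0 ?ltr0n.
  have : 0 <= 36 * (a * b) * P ^+ 2 by rewrite mulr_ge0 //; lra.
  have : 0 <= t ^+ 2 * q by rewrite mulr_ge0 // ltW.
  move=> q1 q2.
  have r1 : 36 * (a * b) * P ^+ 2 = 0 by lra.
  have r2 : t ^+ 2 * q = 0 by lra.
  split; apply/eqP; rewrite -sqrf_eq0; apply/eqP.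
    by move/eqP: r1; rewrite mulf_eq0 gt_eqF ?mulr_gt0 ?ltr0n //= => /eqP.
  by move/eqP: r2; rewrite mulf_eq0 (gt_eqF c0) orbF => /eqP.
clearbody f g.
(* If [f] or [g] vanishes, [e1] and [e2] reduce to [Q = 0] together with [A2 = 0] or [A1 = 0], a
   regular linear system in [P] and [t]. Otherwise the product of [e1] and [e2], divided by [f g],
   is the hypothesis of [quad]. *)
have [f0|f0] := eqVneq f 0; last have [g0|g0] := eqVneq g 0.
- have g0 : g != 0 by move: fg0; rewrite f0 eqxx.
  have Q0 : Q = 0.
    move: e1; rewrite f0 mul0r => /esym/eqP.
    by rewrite !mulf_eq0 (negbTE g0) (gt_eqF b0) pnatr_eq0 /= => /eqP.
  have A0 : A2 = 0.
    by move: e2; rewrite Q0 mulr0 => /eqP; rewrite mulf_eq0 (negbTE g0) => /eqP.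
  have d : (12 * a * (a * b) + 24 * b * (a * b) + 2 * a + b) * t = 0.
    by move: Q0 A0; rewrite /Q /A2 /n; nra.
  have t0 : t = 0.
    move/eqP: d; rewrite mulf_eq0 gt_eqF //= => [/eqP //|].
    by rewrite !addr_gt0 // !mulr_gt0 ?ltr0n.
  by split=> //; move: Q0; rewrite /Q t0; lra.
- have Q0 : Q = 0.
    move: e2; rewrite g0 mul0r => /esym/eqP.
    by rewrite !mulf_eq0 (negbTE f0) (gt_eqF a0) pnatr_eq0 /= => /eqP.
  have A0 : A1 = 0.
    by move: e1; rewrite Q0 mulr0 => /eqP; rewrite mulf_eq0 (negbTE f0) => /eqP.
  have d : (12 * b * (a * b) + 24 * a * (a * b) + 2 * b + a) * t = 0.
    by move: Q0 A0; rewrite /Q /A1 /n; nra.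
  have t0 : t = 0.
    move/eqP: d; rewrite mulf_eq0 gt_eqF //= => [/eqP //|].
    by rewrite !addr_gt0 // !mulr_gt0 ?ltr0n.
  by split=> //; move: Q0; rewrite /Q t0; lra.
- apply: quad; apply: (mulfI (mulf_neq0 f0 g0)).
  have -> : f * g * (A1 * A2) = (f * A1) * (g * A2) by ring.
  by rewrite e1 e2; ring.
Qed.

(** * Solving the real kernel equations case by case *)

Lemma cv3_eq0 (F : fieldType) (u v p : F) :
  cv3 u v p = 0 -> [/\ u = 0, v = 0 & p = 0].
Proof. by rewrite -cv3_0 => /cv3_inj. Qed.

Lemma col_mx4_eq0 (F : fieldType) (x y z w : 'cV[F]_3) :
  col_mx (col_mx x y) (col_mx z w) = 0 -> [/\ x = 0, y = 0, z = 0 & w = 0].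
Proof.
move=> /eqP; rewrite !col_mx_eq0.
by move=> /andP[/andP[/eqP-> /eqP->] /andP[/eqP-> /eqP->]].
Qed.

(** The [lincomb] lemmas take the multipliers of known equations as a certificate and leave an
    identity for [ring] or [field]. *)
Lemma lincomb1 (R : pzRingType) (k z x y : R) : z = 0 -> x - y = k * z -> x = y.
Proof. by move=> -> /eqP; rewrite mulr0 subr_eq0 => /eqP. Qed.

Lemma lincomb2 (R : pzRingType) (k1 k2 z1 z2 x y : R) :
  z1 = 0 -> z2 = 0 -> x - y = k1 * z1 + k2 * z2 -> x = y.
Proof. by move=> -> -> /eqP; rewrite !mulr0 addr0 subr_eq0 => /eqP. Qed.

Lemma lincomb4 (R : pzRingType) (k1 k2 k3 k4 z1 z2 z3 z4 x y : R) :
  z1 = 0 -> z2 = 0 -> z3 = 0 -> z4 = 0 ->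
  x - y = k1 * z1 + k2 * z2 + k3 * z3 + k4 * z4 -> x = y.
Proof. by move=> -> -> -> -> /eqP; rewrite !mulr0 !addr0 subr_eq0 => /eqP. Qed.

Section RealKernel.
Variables (R : realFieldType) (a b X Sx Y Sy : R).
Hypotheses (a0 : 0 < a) (b0 : 0 < b).
Hypotheses (hX : X ^+ 2 + Sx ^+ 2 = 1) (hY : Y ^+ 2 + Sy ^+ 2 = 1).
Variables (uA vA pA uH vH pH uV vV pV uN vN pN : R).
Hypothesis ker : half_mx a b X Sx Y Sy *m
    col_mx (col_mx (cv3 uA vA pA) (cv3 uH vH pH))
           (col_mx (cv3 uV vV pV) (cv3 uN vN pN)) = 0.


Lemma half_ker_no_nodal_velocity :
  (Sx * Y != 0) || (Sy * X != 0) -> uN = 0 -> vN = 0 ->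
  [/\ pA = 0, pH = 0, pV = 0, pN = 0 & uH = 0 /\ vV = 0].
Proof.
move=> fg0 uN0 vN0.
have eX : Sx ^+ 2 = 1 - X ^+ 2 by rewrite -hX; ring.
have eY : Sy ^+ 2 = 1 - Y ^+ 2 by rewrite -hY; ring.
have ab0 : a + b != 0 by rewrite gt_eqF ?addr_gt0.
have an : a != 0 by rewrite gt_eqF.
have bn : b != 0 by rewrite gt_eqF.
move: ker; rewrite half_mxE uN0 vN0 => /col_mx4_eq0 [].
move=> /cv3_eq0[A1 A2 _] /cv3_eq0[H1 H2 H3].
move=> /cv3_eq0[V1 V2 V3] /cv3_eq0[N1 N2 N3].
have {}N1 : 2 * X * uH = Sx * (2 * pH - X * pN).
  by apply: (mulfI an); lra.
have {}N2 : 2 * Y * vV = Sy * (2 * pV - Y * pN).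
  by apply: (mulfI bn); lra.
have [mu euH epH] := edge_amplitude hX N1.
have [nu evV epV] := edge_amplitude hY N2.
have {}N3 : a * (pN - mu) + b * (pN - nu) = 0.
  apply: (lincomb1 (k := 1 / 2) N3).
  by rewrite euH epH evV epV; field: eX eY.
(* [N3] is one linear relation between the amplitudes [mu] and [nu]; [t] parametrises its
   solutions. *)
pose t := (pN - mu) / b.
have emu : mu = pN - b * t by rewrite /t; field.
have enu : nu = pN + a * t.
  apply: (mulfI bn); apply: (lincomb1 (k := -1) N3).
  by rewrite /t; field.
have evA : vA = 2 * a * Sx / 3 * (2 * pV + Y * pN) by move: A1; lra.
have euA : uA = - (2 * b * Sy / 3 * (2 * pH + X * pN)) by move: A2; lra.
have evH : vH = 2 * a * Sx * pN by move: H1; lra.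
have euV : uV = - (2 * b * Sy * pN) by move: V2; lra.
have [P0 t0] : pN = 0 /\ t = 0.
  apply: (amplitudes_eq0 (a := a) (b := b) (X := X) (Sx := Sx) (Y := Y)
    (Sy := Sy)) => //.
  (* The average pressure [pA] drops out of [Y H2 + Sy H3], and in the next goal out of
     [X V1 + Sx V3]. *)
  - apply: (lincomb2 (k1 := - 2 * Y) (k2 := - 2 * Sy) H2 H3).
    by rewrite evA evH evV epV euH epH emu enu; field: eX eY.
  - apply: (lincomb2 (k1 := - 2 * X) (k2 := - 2 * Sx) V1 V3).
    by rewrite euA euV evV epV euH epH emu enu; field: eX eY.
  (* [Y H3 - Sy H2] and [X V3 - Sx V1] contain [pA] with coefficients [- 9 b] and [- 9 a]; this
     combination equates the two resulting values of [pA]. *)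
  - apply: (lincomb4 (k1 := - 2 * a * Y / (a + b)) (k2 := 2 * a * Sy / (a + b))
        (k3 := 2 * b * X / (a + b)) (k4 := - 2 * b * Sx / (a + b)) H3 H2 V3 V1).
    by rewrite evA evH euA euV evV epV euH epH emu enu; field: eX eY.
have pA0 : pA = 0.
  apply: (lincomb2 (k1 := - Y / (9 * b)) (k2 := Sy / (9 * b)) H3 H2).
  by rewrite evA evH evV epV euH epH emu enu P0 t0; field: eX eY.
by rewrite euH evV epH epV pA0 emu enu P0 t0 !(mulr0, addr0, subr0, mul0r).
Qed.

(** This is the case [tx = ty = -1]. [N3] reduces to a positive multiple of [pN]. Eliminating the
    nodal velocity leaves two equations for [h = Sx pH] and [w = Sy pV], whose determinant is, up to
    sign, the positive [q] of [amplitudes_eq0]. *)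
Lemma half_ker_XY0 : X = 0 -> Y = 0 -> pA = 0 ->
  [/\ pH = 0, pV = 0, pN = 0 & [/\ uH = 0, vV = 0, uN = 0 & vN = 0]].
Proof.
move=> X0 Y0 pA0.
have eX : Sx ^+ 2 = 1 by rewrite -hX X0; ring.
have eY : Sy ^+ 2 = 1 by rewrite -hY Y0; ring.
have an : a != 0 by rewrite gt_eqF.
have bn : b != 0 by rewrite gt_eqF.
have ab := mulr_gt0 a0 b0.
move: ker; rewrite half_mxE X0 Y0 pA0 => /col_mx4_eq0 [].
move=> /cv3_eq0[A1 A2 _] /cv3_eq0[H1 H2 H3].
move=> /cv3_eq0[V1 V2 V3] /cv3_eq0[N1 N2 N3].
have evA : vA = 4 * a * Sx / 3 * pV by move: A1; lra.
have euA : uA = - (4 * b * Sy / 3 * pH) by move: A2; lra.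
have evH : vH = 2 * a * Sx * pN by move: H1; lra.
have euV : uV = - (2 * b * Sy * pN) by move: V2; lra.
have euH : uH = - (4 * a * b * Sx * pN) by move: H2; rewrite evH; lra.
have evV : vV = - (4 * a * b * Sy * pN) by move: V1; rewrite euV; lra.
have pN0 : pN = 0.
  have : (a + b) * (16 * (a * b) + 2) * pN = 0.
    apply: (lincomb1 (k := 1) N3).
    by rewrite euH evV; ring: eX eY.
  move/eqP; rewrite mulf_eq0 gt_eqF /= => [/eqP //|].
  by rewrite mulr_gt0 ?addr_gt0 ?mulr_gt0 ?ltr0n.
pose h := Sx * pH; pose w := Sy * pV.
have euN : uN = (b * h - 6 * a * b * w) / a.
  apply: (lincomb1 (k := - Sx / (2 * a)) H3).
  by rewrite evA evH /h /w; field: eX eY.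
have evN : vN = (a * w + 6 * a * b * h) / b.
  apply: (lincomb1 (k := - Sy / (2 * b)) V3).
  by rewrite euA euV /h /w; field: eX eY.
have r1 : w * (a + 12 * a * b ^+ 2) = 2 * b * (b - a) * h.
  apply: (lincomb1 (k := - b) N1).
  by rewrite evN euN pN0 /h /w; field: eX eY; rewrite ?an ?bn.
have r2 : 2 * a * (b - a) * w = h * (12 * a ^+ 2 * b + b).
  apply: (lincomb1 (k := - a) N2).
  by rewrite evN euN pN0 /h /w; field: eX eY; rewrite ?an ?bn.
have h0 : h = 0.
  have : (a * b * (1 + 12 * (a ^+ 2 + b ^+ 2) + 144 * (a * b) ^+ 2
                   - 4 * (a - b) ^+ 2)) * h = 0.
    have := congr1 (fun z => 2 * a * (b - a) * z) r1.
    have := congr1 (fun z => (a + 12 * a * b ^+ 2) * z) r2.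
    lra.
  move/eqP; rewrite mulf_eq0 gt_eqF /= => [/eqP //|].
  apply: mulr_gt0 => //.
  by have := sqr_ge0 a; have := sqr_ge0 b; have := sqr_ge0 (a * b); nra.
have w0 : w = 0.
  move: r1; rewrite h0 mulr0 => /eqP.
  rewrite mulf_eq0 [X in _ || X]gt_eqF ?orbF => [/eqP //|].
  by rewrite addr_gt0 // !mulr_gt0 ?exprn_gt0 ?ltr0n.
have -> : pH = 0 by rewrite -[pH]mul1r -eX expr2 -mulrA -/h h0 mulr0.
have -> : pV = 0 by rewrite -[pV]mul1r -eY expr2 -mulrA -/w w0 mulr0.
by rewrite euN evN euH evV h0 w0 pN0 !(mulr0, mul0r, subr0, addr0, oppr0).
Qed.

(** This is the case [tx = ty = 1], where velocities and pressures decouple. The velocities reduce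
    to two equations for [h = X uH] and [w = Y vV] with determinant [36 a b + (12 a b - 1)^2], up to
    sign; for the pressures, [pA = 0] excludes the constant state. *)
Lemma half_ker_S0 : Sx = 0 -> Sy = 0 -> pA = 0 ->
  [/\ pH = 0, pV = 0, pN = 0 & [/\ uH = 0, vV = 0, uN = 0 & vN = 0]].
Proof.
move=> S0 T0 pA0.
have eX : X ^+ 2 = 1 by rewrite -hX S0; ring.
have eY : Y ^+ 2 = 1 by rewrite -hY T0; ring.
have an : a != 0 by rewrite gt_eqF.
have bn : b != 0 by rewrite gt_eqF.
have ab := mulr_gt0 a0 b0.
move: ker; rewrite half_mxE S0 T0 pA0 => /col_mx4_eq0 [].
move=> /cv3_eq0[A1 A2 _] /cv3_eq0[H1 H2 H3].
move=> /cv3_eq0[V1 V2 V3] /cv3_eq0[N1 N2 N3].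
have vA0 : vA = 0 by move: A1; lra.
have uA0 : uA = 0 by move: A2; lra.
have vH0 : vH = 0 by move: H1; lra.
have uV0 : uV = 0 by move: V2; lra.
move: H2 H3 V1 V3; rewrite vA0 uA0 vH0 uV0 => H2 H3 V1 V3.
pose h := X * uH; pose w := Y * vV.
have evN : vN = 4 * a * (uN - h).
  apply: (lincomb1 (k := - 1) N1).
  by rewrite /h; ring: eX eY.
have euN : uN = 4 * b * (w - vN).
  apply: (lincomb1 (k := 1) N2).
  by rewrite /w; ring: eX eY.
have eh : h = - b * (2 * w + vN).
  apply: (lincomb1 (k := X) H2).
  by rewrite /w /h; ring: eX eY.
have ew : w = a * (2 * h + uN).
  apply: (lincomb1 (k := - Y) V1).
  by rewrite /w /h; ring: eX eY.
have r1 : 6 * b * w = h * (12 * a * b - 1).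
  have := congr1 (fun z => b * z) evN; have := congr1 (fun z => b * z) ew; lra.
have r2 : 6 * a * h = w * (1 - 12 * a * b).
  have := congr1 (fun z => a * z) euN; have := congr1 (fun z => a * z) eh; lra.
have h0 : h = 0.
  have : (36 * (a * b) + (12 * a * b - 1) ^+ 2) * h = 0.
    have := congr1 (fun z => 6 * b * z) r2.
    have := congr1 (fun z => (1 - 12 * a * b) * z) r1.
    lra.
  move/eqP; rewrite mulf_eq0 gt_eqF /= => [/eqP //|].
  by apply: ltr_wpDr; rewrite ?sqr_ge0 // mulr_gt0.
have w0 : w = 0.
  apply: (mulfI bn); move: r1; rewrite h0; lra.
have uN0 : uN = 0 by apply: (mulfI an); move: ew; rewrite h0 w0; lra.
have vN0 : vN = 0 by rewrite evN uN0 h0; ring.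
pose ph := X * pH; pose pv := Y * pV.
have s1 : 6 * ph + 2 * pv + pN = 0.
  apply: (mulfI bn); apply: (lincomb1 (k := X) H3).
  by rewrite /ph /pv uN0 vN0; ring: eX eY.
have s2 : 6 * pv + 2 * ph + pN = 0.
  apply: (mulfI an); apply: (lincomb1 (k := Y) V3).
  by rewrite /ph /pv uN0 vN0; ring: eX eY.
have pe : ph = pv by lra.
have eN : pN = - (8 * ph) by lra.
have ph0 : ph = 0.
  have abn : 36 * (a + b) != 0 by rewrite gt_eqF // mulr_gt0 ?addr_gt0.
  apply: (mulfI abn); apply: (lincomb1 (k := - 1) N3).
  have -> :
     a * (- 4 * 0 * uH - 4 * X * pH + (2 + 2 * X ^+ 2) * pN + 2 * 0 * X * uN) +
     b * (- 4 * 0 * vV - 4 * Y * pV + (2 + 2 * Y ^+ 2) * pN + 2 * 0 * Y * vN)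
     = 4 * a * (pN - ph) + 4 * b * (pN - pv) by rewrite /ph /pv; ring: eX eY.
  by rewrite -pe eN; ring.
have -> : uH = 0 by rewrite -[uH]mul1r -eX expr2 -mulrA -/h h0 mulr0.
have -> : vV = 0 by rewrite -[vV]mul1r -eY expr2 -mulrA -/w w0 mulr0.
have -> : pH = 0 by rewrite -[pH]mul1r -eX expr2 -mulrA -/ph ph0 mulr0.
have -> : pV = 0 by rewrite -[pV]mul1r -eY expr2 -mulrA -/pv -pe ph0 mulr0.
by rewrite eN ph0 uN0 vN0 !(mulr0, oppr0).
Qed.
End RealKernel.

(** * One-dimensionality of the kernel over the real and the complex field *)

Lemma half_ker_zero (R : realFieldType) (a b X Sx Y Sy : R)
    (uA vA pA uH vH pH uV vV pV uN vN pN : R) :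
  half_mx a b X Sx Y Sy *m
    col_mx (col_mx (cv3 uA vA pA) (cv3 uH vH pH))
           (col_mx (cv3 uV vV pV) (cv3 uN vN pN)) = 0 ->
  pA = 0 ->
  [/\ pH = 0, pV = 0, pN = 0 & [/\ uH = 0, vV = 0, uN = 0 & vN = 0]] ->
  col_mx (col_mx (cv3 uA vA pA) (cv3 uH vH pH))
         (col_mx (cv3 uV vV pV) (cv3 uN vN pN)) = 0.
Proof.
move=> kv p0 [q0 r0 s0 [t0 u0 v0 w0]]; move: kv.
rewrite p0 q0 r0 s0 t0 u0 v0 w0 half_mxE => /col_mx4_eq0 [].
(* The balance of Coriolis force and pressure gradient in [A1], [A2], [H1], [V2] returns the four
   remaining velocities. *)
move=> /cv3_eq0[A1 A2 _] /cv3_eq0[H1 _ _] /cv3_eq0[_ V2 _] _.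
have -> : uA = 0 by lra.
have -> : vA = 0 by lra.
have -> : vH = 0 by lra.
have -> : uV = 0 by lra.
by rewrite !cv3_0 !col_mx0.
Qed.

Lemma half_mx_kerP (R : realFieldType) (a b X Sx Y Sy : R)
    (y : 'cV[R]_(3 + 3 + (3 + 3))) : 0 < a -> 0 < b ->
  X ^+ 2 + Sx ^+ 2 = 1 -> Y ^+ 2 + Sy ^+ 2 = 1 ->
  half_mx a b X Sx Y Sy *m y = 0 ->
  exists l, y = l *: half_ker a b X Sx Y Sy.
Proof.
move=> a0 b0 hX hY ky.
have [k] : exists k, y + k *: half_ker a b X Sx Y Sy = 0; last first.
  by move=> /eqP; rewrite addr_eq0 => /eqP ->; exists (- k); rewrite scaleNr.
have : forall k, half_mx a b X Sx Y Sy *m (y + k *: half_ker a b X Sx Y Sy) = 0.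
  by move=> k; rewrite mulmxDr -scalemxAr half_mx_ker // scaler0 ky addr0.
move: ky; rewrite -[y]vsubmxK -[usubmx y]vsubmxK -[dsubmx y]vsubmxK.
rewrite [usubmx (usubmx y)]cv3E [dsubmx (usubmx y)]cv3E.
rewrite [usubmx (dsubmx y)]cv3E [dsubmx (dsubmx y)]cv3E.
set uA := usubmx (usubmx y) 0 0; set vA := usubmx (usubmx y) 1 0.
set pA := usubmx (usubmx y) (inord 2) 0.
set uH := dsubmx (usubmx y) 0 0; set vH := dsubmx (usubmx y) 1 0.
set pH := dsubmx (usubmx y) (inord 2) 0.
set uV := usubmx (dsubmx y) 0 0; set vV := usubmx (dsubmx y) 1 0.
set pV := usubmx (dsubmx y) (inord 2) 0.
set uN := dsubmx (dsubmx y) 0 0; set vN := dsubmx (dsubmx y) 1 0.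
set pN := dsubmx (dsubmx y) (inord 2) 0.
clearbody uA vA pA uH vH pH uV vV pV uN vN pN.
move=> ky kk.
have normalize_pA : exists k,
    pA + k * ((1 + 2 * X ^+ 2) * (1 + 2 * Y ^+ 2) / 9) = 0.
  exists (- pA / ((1 + 2 * X ^+ 2) * (1 + 2 * Y ^+ 2) / 9)); field.
  have h (z : R) : 1 + 2 * z ^+ 2 != 0.
    by rewrite gt_eqF // ltr_pwDl // mulr_ge0 ?sqr_ge0.
  by rewrite !h.
have [fg0|] := boolP ((Sx * Y != 0) || (Sy * X != 0)).
- pose f := Sx * Y; pose g := Sy * X.
  have d0 : (a * f) ^+ 2 + (b * g) ^+ 2 != 0.
    rewrite paddr_eq0 ?sqr_ge0 // !sqrf_eq0 !mulf_eq0.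
    rewrite (gt_eqF a0) (gt_eqF b0) /=.
    by rewrite negb_and; move: fg0; rewrite /f /g !mulf_eq0.
  (* After insertion of [vH] and [uV] from [H1] and [V2], the terms in [pN] cancel from the
     divergence equation. *)
  have A3 : b * g * vN + a * f * uN = 0.
    move: ky; rewrite half_mxE => /col_mx4_eq0 [].
    move=> /cv3_eq0[_ _ A3] /cv3_eq0[H1 _ _] /cv3_eq0[_ V2 _] _.
    have evH : vH = 2 * a * Sx * pN by move: H1; lra.
    have euV : uV = - (2 * b * Sy * pN) by move: V2; lra.
    apply: (lincomb1 (k := - 3 / 2) A3).
    by rewrite evH euV /f /g; field.
  (* By [A3] the nodal velocity is a multiple of [(- b g, a f)], half the nodal velocity of
     [half_ker]; [k] is minus the coefficient with respect to the latter. *)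
  pose k := (uN * (b * g) - vN * (a * f)) / (2 * ((a * f) ^+ 2 + (b * g) ^+ 2)).
  have uN0 : uN + k * - (2 * b * Sy * X) = 0.
    apply: (lincomb1 (k := a * f / ((a * f) ^+ 2 + (b * g) ^+ 2)) A3).
    by rewrite /k -(mulrA _ Sy X) -/g; field.
  have vN0 : vN + k * (2 * a * Sx * Y) = 0.
    apply: (lincomb1 (k := b * g / ((a * f) ^+ 2 + (b * g) ^+ 2)) A3).
    by rewrite /k -(mulrA _ Sx Y) -/f; field.
  exists k; have := kk k.
  rewrite /half_ker !scale_col_mx !add_col_mx !scalecv3 !addcv3 => kk'.
  have [pA0 pH0 pV0 pN0 [uH0 vV0]] :=
    half_ker_no_nodal_velocity a0 b0 hX hY kk' fg0 uN0 vN0.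
  by apply: (half_ker_zero kk' pA0).
(* Now [half_ker] has no nodal velocity, so the average pressure fixes the multiple. A cosine and
   its sine cannot both vanish, which leaves [Sx = Sy = 0] or [X = Y = 0]. *)
rewrite negb_or !negbK !mulf_eq0 => fg0.
have [k pA0] := normalize_pA; exists k; have := kk k.
rewrite /half_ker !scale_col_mx !add_col_mx !scalecv3 !addcv3 => kk'.
apply: (half_ker_zero kk' pA0).
have [Sx0|Sx0] := eqVneq Sx 0.
  have X0 : X != 0.
    by apply: contra_eq_neq hX => ->; rewrite Sx0 expr0n addr0 eq_sym oner_neq0.
  move: fg0; rewrite (negbTE X0) orbF => /andP[_ /eqP Sy0].
  exact: (half_ker_S0 a0 b0 hX hY kk').
move: fg0; rewrite (negbTE Sx0) /= => /andP[/eqP Y0].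
have Sy0 : Sy != 0.
  by apply: contra_eq_neq hY => ->; rewrite Y0 expr0n addr0 eq_sym oner_neq0.
rewrite (negbTE Sy0) /= => /eqP X0.
exact: (half_ker_XY0 a0 b0 hX hY kk').
Qed.

(** The matrix is real, so the real and imaginary parts of a kernel element are themselves in the
    kernel. *)
Lemma half_mx_kerP_complex (R : rcfType) (a b X Sx Y Sy : R)
    (y : 'cV[R[i]]_(3 + 3 + (3 + 3))) : 0 < a -> 0 < b ->
  X ^+ 2 + Sx ^+ 2 = 1 -> Y ^+ 2 + Sy ^+ 2 = 1 ->
  half_mx a%:C b%:C X%:C Sx%:C Y%:C Sy%:C *m y = 0 ->
  exists l, y = l *: half_ker a%:C b%:C X%:C Sx%:C Y%:C Sy%:C.
Proof.
move=> a0 b0 hX hY.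
rewrite -(map_half_mx (real_complex R)) -(map_half_ker (real_complex R)).
have -> : y = map_mx (real_complex R) (map_mx (@complex.Re R) y)
            + 'i *: map_mx (real_complex R) (map_mx (@complex.Im R) y).
  by apply/matrixP => i j; rewrite !mxE; case: (y i j) => u v; simpc.
rewrite mulmxDr -scalemxAr -!map_mxM => ky.
have [y1 y2] : half_mx a b X Sx Y Sy *m map_mx (@complex.Re R) y = 0 /\
               half_mx a b X Sx Y Sy *m map_mx (@complex.Im R) y = 0.
  split; apply/matrixP => i j; move/matrixP: ky => /(_ i j);
    rewrite !mxE; simpc => -[] //.
have [l1 ->] := half_mx_kerP a0 b0 hX hY y1.
have [l2 ->] := half_mx_kerP a0 b0 hX hY y2.
exists (l1%:C + 'i * l2%:C).
by rewrite !map_mxZ scalerA -scalerDl.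
Qed.

(** * Half-angle formulas for the complex exponential *)

Lemma expi_half (R : realType) (x : R) : expi x = expi (x / 2) ^+ 2.
Proof.
rewrite /expi expr2 {1 2}(_ : x = x / 2 + x / 2); last by field.
by rewrite cosD sinD; simpc; congr Complex; ring.
Qed.

Lemma expi_neq0 (R : realType) (x : R) : expi x != 0.
Proof.
apply/eqP => -[c0 s0]; have := cos2Dsin2 x.
by rewrite c0 s0 expr0n addr0 => /esym/eqP; rewrite oner_eq0.
Qed.

Lemma expiV (R : realType) (x : R) : (expi x)^-1 = Complex (cos x) (- sin x).
Proof.
have h : Complex (cos x) (- sin x) * expi x = 1.
  rewrite /expi; simpc; apply/eqP; rewrite eq_complex /=; apply/andP; split.
    by rewrite -(cos2Dsin2 x); apply/eqP; ring.
  by apply/eqP; ring.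
by rewrite -[LHS]mul1r -h mulfK ?expi_neq0.
Qed.

Lemma expi_cos (R : realType) (x : R) : (expi x + (expi x)^-1) / 2 = (cos x)%:C.
Proof.
apply: (mulIf (_ : 2 != 0)); first by rewrite pnatr_eq0.
rewrite divfK ?pnatr_eq0 // expiV /expi mulr_natr mulr2n.
by simpc; congr Complex; ring.
Qed.

Lemma expi_sin (R : realType) (x : R) :
  - ('i * (expi x - (expi x)^-1) / 2) = (sin x)%:C.
Proof.
apply: (mulIf (_ : 2 != 0)); first by rewrite pnatr_eq0.
rewrite mulNr divfK ?pnatr_eq0 // expiV /expi mulr_natr mulr2n.
by simpc; congr Complex; ring.
Qed.

(** * Transfer of the kernel along the similarity *)

Lemma phase_mx_unit (F : fieldType) (i s r : F) : i != 0 -> s != 0 -> r != 0 ->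
  phase_mx i s r \in unitmx.
Proof.
have du (k j : F) : k != 0 -> j != 0 -> k *: diag3 j \in unitmx.
  move=> k0 j0.
  have : (k *: diag3 j) *m (k^-1 *: diag3 j^-1) = 1%:M.
    rewrite /diag3 !scale_mx3 mul_mx3; apply/matrixP => p q; rewrite !mxE.
    case: p => [[|[|[|]]]] //= ?; case: q => [[|[|[|]]]] //= ?; field;
      rewrite ?j0 ?k0 //.
  by case/mulmx1_unit.
move=> i0 s0 r0; rewrite unitmxE /phase_mx !det_ublock !unitrM -!unitmxE.
have d1 : diag3 i \in unitmx by rewrite -[diag3 i]scale1r du ?oner_neq0.
by rewrite d1 !du // mulf_neq0.
Qed.

(** The relation reads [E = c D K D^-1] with [c] nonzero, so [D] carries the kernel of [K] onto that
    of [E]. *)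
Lemma ker_similar (F : fieldType) (n : nat) (E D K : 'M[F]_n) (c : F)
    (w : 'cV[F]_n) :
  c != 0 -> D \in unitmx -> E *m D = c *: (D *m K) -> K *m w = 0 ->
  (forall y : 'cV[F]_n, K *m y = 0 -> exists l, y = l *: w) ->
  lker (linfun (mulmx E : 'cV_n -> 'cV_n)) = <[D *m w]>%VS.
Proof.
move=> c0 Du ED Kw Kinj; apply/vspaceP => q; rewrite memv_ker lfunE /=.
apply/eqP/vlineP => [Eq0|[k ->]].
  have /Kinj[l hl] : K *m (invmx D *m q) = 0.
    have : c *: (D *m (K *m (invmx D *m q))) = 0.
      by rewrite mulmxA scalemxAl -ED -mulmxA mulKVmx.
    move=> /eqP; rewrite scaler_eq0 (negbTE c0) /= => /eqP DK.
    by rewrite -[LHS](mulKmx Du) DK mulmx0.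
  by exists l; rewrite -[q](mulKVmx Du) hl -scalemxAr.
by rewrite -scalemxAr mulmxA ED -scalemxAl -mulmxA Kw mulmx0 !scaler0.
Qed.

Lemma det_eq0_lker (F : fieldType) (n : nat) (E : 'M[F]_n) :
  lker (linfun (mulmx E : 'cV_n -> 'cV_n)) != 0%VS -> \det E = 0.
Proof.
(* [det0P] asks for a row vector in the left kernel, hence the transpose. *)
move=> ker0; apply/eqP; rewrite -det_tr; apply/det0P.
pose v := vpick (lker (linfun (mulmx E : 'cV_n -> 'cV_n))).
have Ev : E *m v = 0.
  have := memv_pick (lker (linfun (mulmx E : 'cV_n -> 'cV_n))).
  by rewrite memv_ker lfunE => /eqP.
exists v^T; last by rewrite -trmx_mul Ev trmx0.
by rewrite -(inj_eq (can_inj (@trmxK _ _ _))) trmxK trmx0 vpick0.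
Qed.

Lemma vlineZ (F : fieldType) (V : vectType F) (k : F) (v : V) :
  k != 0 -> <[k *: v]>%VS = <[v]>%VS.
Proof.
move=> k0; apply/vspaceP => q; apply/vlineP/vlineP => -[l ->].
  by exists (l * k); rewrite scalerA.
by exists (l / k); rewrite scalerA divfK.
Qed.

Lemma half_ker_neq0 (R : realFieldType) (a b X Sx Y Sy : R) :
  half_ker a b X Sx Y Sy != 0.
Proof.
have pos (z : R) : 0 < 1 + 2 * z ^+ 2 by rewrite ltr_pwDl // mulr_ge0 ?sqr_ge0.
apply/eqP => /col_mx4_eq0[/cv3_eq0[_ _ /eqP]].
by rewrite gt_eqF // divr_gt0 ?mulr_gt0.
Qed.

(** * Determinant and kernel of the evolution matrix *)

Theorem theorem4p1 (R : realType) (c dx dy : R)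
    (hc : 0 < c) (hdx : 0 < dx) (hdy : 0 < dy) (kx ky : R) :
  let tx := expi (kx * dx) in
  let ty := expi (ky * dy) in
  let E := evolution_mx c%:C dx%:C dy%:C tx ty in
  let kerE := lker (linfun (mulmx E : 'cV_(3 + 3 + (3 + 3)) -> 'cV_(3 + 3 + (3 + 3))))
  in
  [/\ \det E = 0,
      \dim kerE = 1%N
    & 1 + tx != 0 -> 1 + ty != 0 ->
      kerE = <[ker_vec c%:C dx%:C dy%:C tx ty]>%VS].
Proof.
move=> tx ty E kerE.
pose s := expi (kx * dx / 2); pose r := expi (ky * dy / 2).
pose X := cos (kx * dx / 2); pose Sx := sin (kx * dx / 2).
pose Y := cos (ky * dy / 2); pose Sy := sin (ky * dy / 2).
pose a := (c * dx)^-1; pose b := (c * dy)^-1.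
pose K := half_mx a%:C b%:C X%:C Sx%:C Y%:C Sy%:C.
pose w := half_ker a%:C b%:C X%:C Sx%:C Y%:C Sy%:C.
pose D := phase_mx 'i s r.
have ii : 'i ^+ 2 = - 1 :> R[i] by rewrite sqr_i.
have i0 : 'i != 0 :> R[i] by rewrite -sqrf_eq0 ii oppr_eq0 oner_neq0.
have rc0 (x : R) : 0 < x -> x%:C != 0 by move=> x0; rewrite fmorph_eq0 gt_eqF.
have [c0 dx0 dy0] := And3 (rc0 _ hc) (rc0 _ hdx) (rc0 _ hdy).
have s0 : s != 0 by apply: expi_neq0.
have r0 : r != 0 by apply: expi_neq0.
have a0 : 0 < a by rewrite invr_gt0 mulr_gt0.
have b0 : 0 < b by rewrite invr_gt0 mulr_gt0.
have hX : X ^+ 2 + Sx ^+ 2 = 1 by apply: cos2Dsin2.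
have hY : Y ^+ 2 + Sy ^+ 2 = 1 by apply: cos2Dsin2.
have Du : D \in unitmx by apply: phase_mx_unit.
have aE : (c%:C * dx%:C)^-1 = a%:C by rewrite /a fmorphV rmorphM.
have bE : (c%:C * dy%:C)^-1 = b%:C by rewrite /b fmorphV rmorphM.
have ED : E *m D = c%:C *: (D *m K).
  have := evolution_half ii c0 dx0 dy0 s0 r0.
  by rewrite !expi_cos !expi_sin -!expi_half aE bE.
have Kw : K *m w = 0.
  rewrite /K /w -(map_half_mx (real_complex R)) -(map_half_ker (real_complex R)).
  by rewrite -map_mxM half_mx_ker // map_mx0.
have w0 : w != 0.
  by rewrite /w -(map_half_ker (real_complex R)) map_mx_eq0 half_ker_neq0.
have Dw0 : D *m w != 0.
  by apply: contraNneq w0 => Dw; rewrite -[w](mulKmx Du) Dw mulmx0.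
have kerEE : kerE = <[D *m w]>%VS.
  by apply: (ker_similar c0 Du ED Kw) => y; apply: half_mx_kerP_complex.
have dim1 : \dim kerE = 1%N by rewrite kerEE dim_vline Dw0.
split=> //.
- by apply: det_eq0_lker; rewrite -dimv_eq0 dim1.
- move=> tx1 ty1; rewrite kerEE.
  have Dw : D *m w = (s * r * X%:C * Y%:C) *: ker_vec c%:C dx%:C dy%:C tx ty.
    have := ker_vec_half ii c0 dx0 dy0 s0 r0.
    by rewrite !expi_cos !expi_sin -!expi_half aE bE; apply.
  (* The cosines need no separate discussion: a vanishing factor would make [D *m w] zero. *)
  have k0 : s * r * X%:C * Y%:C != 0.
    by apply: contraNneq Dw0 => k0; rewrite Dw k0 scale0r.
  by rewrite Dw vlineZ.
Qed.
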